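(* For every $m\in\mathbb{N}$, the Minkowski dimensions of $E_m$ and $A_m$ exist and $$\dim_{\rm M}E_m=\dim_{\rm M}A_m=1-\frac1{2^m}.$$
   Context: $\mathbb{N}$ is the set of positive integers. Minkowski dimension: for a non-empty bounded set $\Omega\subset\mathbb{R}$ and $r>0$, let $\mathcal{N}_r(\Omega)$ be the smallest number of closed intervals of length $r$ needed to cover $\Omega$. Put $\overline{\dim}_{\rm M}\Omega=\limsup_{r\to0^+}\frac{\log \mathcal{N}_r(\Omega)}{-\log r}$ and $\underline{\dim}_{\rm M}\Omega=\liminf_{r\to0^+}\frac{\log \mathcal{N}_r(\Omega)}{-\log r}$. If they coincide, the common value is the Minkowski dimension $\dim_{\rm M}\Omega$. Egyptian fractions (greedy): for a rational $x\in(0,1]$, the Egyptian fraction of $x$ is the expression $x=\frac1{a_1}+\cdots+\frac1{a_k}$ where $a_1<a_2<\cdots<a_k$ are positive integers satisfying $$\sum_{i=1}^{\ell}\frac1{a_i}\le x<\sum_{i=1}^{\ell-1}\frac1{a_i}+\frac1{a_\ell-1},\qquad 1\le\ell\le k,$$ with the convention $\frac10=+\infty$. The integer $k$ is the length of the Egyptian fraction of $x$. For $m\in\mathbb{N}$, $E_m$ is the set of all $x\in(0,1]\cap\mathbb{Q}$ whose Egyptian fraction has length $m$. Also $E_0=\{0\}$, and $A_m=\bigcup_{p=0}^m E_p$. *)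

(* Defs.v *)
From HB Require Import structures.
From mathcomp Require Import all_boot all_order all_algebra.
From mathcomp Require Import all_classical all_reals all_analysis.

Set Implicit Arguments.
Unset Strict Implicit.
Unset Printing Implicit Defensive.

Import Order.TTheory GRing.Theory Num.Theory.
Import numFieldNormedType.Exports.

Local Open Scope classical_set_scope.
Local Open Scope ring_scope.

Definition coverable (R : realType) (r : R) (A : set R) (n : nat) : Prop :=
  exists c : 'I_n -> R,
    A `<=` \bigcup_(i in [set: 'I_n]) `[c i, c i + r]%classic.

(* The default value 0 is only taken when no finite cover exists, i.e. never
   for a bounded A and r > 0. *)
Definition covering_number (R : realType) (r : R) (A : set R) : nat :=
  xget 0%N
    [set n | coverable r A n /\ forall k, coverable r A k -> (n <= k)%N].

Definition covering_ratio (R : realType) (A : set R) (r : R) : R :=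
  ln (covering_number r A)%:R / - ln r.

Definition upper_minkowski_dim (R : realType) (A : set R) : \bar R :=
  limf_esup (fun r => (covering_ratio A r)%:E) 0^'+.

Definition lower_minkowski_dim (R : realType) (A : set R) : \bar R :=
  limf_einf (fun r => (covering_ratio A r)%:E) 0^'+.

(* The Minkowski dimension is only defined for non-empty bounded sets, so
   having one includes these two conditions. *)
Definition has_minkowski_dim (R : realType) (A : set R) (d : R) : Prop :=
  [/\ A !=set0, bounded_set A,
      upper_minkowski_dim A = d%:E & lower_minkowski_dim A = d%:E].

Definition unit_sum (R : realType) (a : seq nat) (l : nat) : R :=
  \sum_(i < l) (nth 0%N a i)%:R^-1.

(* The denominators a_1, ..., a_k are the entries 0, ..., k - 1 of a, so that
   l here is the informal index minus one. The last inequality is between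
   extended reals because 0^-1 = +oo in \bar R, as needed when a_l = 1. *)
Definition is_egyptian_fraction (R : realType) (x : R) (a : seq nat) : Prop :=
  [/\ all (fun n => 0 < n)%N a, sorted ltn a, x = unit_sum R a (size a) &
      forall l, (l < size a)%N ->
        unit_sum R a l.+1 <= x /\
        (x%:E < (unit_sum R a l)%:E + ((nth 0%N a l - 1)%:R%:E)^-1)%E].

Definition egyptian_set (R : realType) (m : nat) : set R :=
  if m is 0 then [set 0]
  else [set x : R | [/\ x \in `]0, 1], rational x &
                    exists2 a, is_egyptian_fraction x a & size a = m]].
Arguments egyptian_set : clear implicits.

Definition egyptian_set_le (R : realType) (m : nat) : set R :=
  \bigcup_(p in [set p | (p <= m)%N]) egyptian_set R p.
Arguments egyptian_set_le : clear implicits.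

(* Main.v *)
(** Both bounds rest on the scale [s] with [r = s^-(2^m)], for which the claimed
    covering number is of order [s^(2^m - 1)].
    Upper bound: sums with first denominator [> M] lie in [[0, 1/M]], the others
    in the [M] translates [1/a + A_(m-1)], so [N_r(A_m) <= M N_r(A_(m-1)) + 1/(Mr) + 1];
    take [M] close to [s] and apply induction with [s^2].
    Lower bound: let the first denominator run over [[S, 2S)], the second over
    [[8S^2, 16S^2)], and so on, replacing [S] by [8S^2] at each step. All these
    expansions are greedy, their sums are [(8S)^-(2^m)]-separated, and there are
    [(8S)^(2^m - 1) / 8^m] of them; take [8S] close to [s]. *)
Require Import Defs.
From HB Require Import structures.
From mathcomp Require Import all_boot all_order all_algebra.
From mathcomp Require Import all_classical all_reals all_analysis.
From mathcomp Require Import ring lra zify.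

Set Implicit Arguments.
Unset Strict Implicit.
Unset Printing Implicit Defensive.

Import Order.TTheory GRing.Theory Num.Theory.
Import numFieldNormedType.Exports.

Local Open Scope classical_set_scope.
Local Open Scope ring_scope.

(** * Minkowski dimension from power bounds on covering numbers *)

Lemma cvg_limf_esup (R : realType) (F : set_system R) (f : R -> R) (d : R) :
  ProperFilter F -> f x @[x --> F] --> d ->
  limf_esup (fun x => (f x)%:E) F = d%:E.
Proof.
move=> FF fd.
have Fd e : 0 < e -> F [set x | `|d - f x| < e].
  by move=> e0; move/cvgrPdist_lt: fd; apply.
apply/eqP; rewrite eq_le limf_esupE; apply/andP; split.
- apply/lee_addgt0Pr => e e0; apply: ge_ereal_inf.
  exists (ereal_sup ((fun x => (f x)%:E) @` [set x | `|d - f x| < e])).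
    by exists [set x | `|d - f x| < e] => //; exact: Fd.
  apply: ge_ereal_sup => _ [x /= dfx <-].
  by rewrite -EFinD lee_fin; move: dfx; rewrite ltr_norml; lra.
- apply: le_ereal_inf_tmp => _ [V FV <-].
  apply/lee_subgt0Pr => e e0.
  have [x [Vx /= dfx]] := @filter_ex _ F _ _ (filterI FV (Fd e e0)).
  apply: ereal_sup_ge; exists (f x)%:E; first by exists x.
  by rewrite -EFinD lee_fin; move: dfx; rewrite ltr_norml; lra.
Qed.

Lemma cvg_limf_einf (R : realType) (F : set_system R) (f : R -> R) (d : R) :
  ProperFilter F -> f x @[x --> F] --> d ->
  limf_einf (fun x => (f x)%:E) F = d%:E.
Proof.
move=> FF fd; rewrite /limf_einf -[RHS]oppeK; congr (- _)%E.
exact: (@cvg_limf_esup _ _ (fun x => - f x) (- d) _ (cvgN fd)).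
Qed.

Lemma covering_number_le (R : realType) (r : R) (A : set R) n :
  coverable r A n -> (covering_number r A <= n)%N.
Proof.
move=> An; rewrite /covering_number; case: xgetP => [k _ [_]|]; first exact.
by [].
Qed.

(** One finite cover already forces a least count to exist, so the default [0] of [xget] is not the
    value taken. *)
Lemma covering_numberP (R : realType) (r : R) (A : set R) n :
  coverable r A n -> coverable r A (covering_number r A).
Proof.
move=> An; rewrite /covering_number; case: xgetP => [k _ []//|no].
have exA : exists k, `[< coverable r A k >] by exists n; exact/asboolP.
case: (ex_minnP exA) => k /asboolP Ak kmin.
by case: (no k); split => // j /asboolP; exact: kmin.
Qed.

(** After taking logarithms, the two bounds keep [ln N + d * ln r] between [ln c] and [ln C];
    dividing by [- ln r], which tends to infinity, makes these constants vanish. *)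
Lemma has_minkowski_dim_power_bounds (R : realType) (A : set R) (d c C : R) :
  A !=set0 -> bounded_set A -> 0 < c ->
  (\forall r \near 0^'+, exists2 n, coverable r A n & n%:R <= C * r `^ (- d)) ->
  (\forall r \near 0^'+, forall n, coverable r A n -> c * r `^ (- d) <= n%:R) ->
  has_minkowski_dim A d.
Proof.
move=> A0 bA c0 upA lowA.
suff lim : covering_ratio A r @[r --> 0^'+] --> d.
  by split => //; [exact: cvg_limf_esup|exact: cvg_limf_einf].
apply/cvgrPdist_lt => e e0.
pose K := `|ln c| + `|ln C|.
near=> r.
have r0 : 0 < r by near: r; exact: nbhs_right_gt.
have [n An nC] : exists2 n, coverable r A n & n%:R <= C * r `^ (- d).
  by near: r.
have := covering_number_le An; rewrite -(ler_nat R) => Nn.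
have cN : c * r `^ (- d) <= (covering_number r A)%:R.
  have lowr : forall n, coverable r A n -> c * r `^ (- d) <= n%:R by near: r.
  exact/lowr/(covering_numberP An).
have L0 : ln r < - ((K + 1) / e).
  by near: r; move/cvgrNy_lt: (@lnNy R); apply.
rewrite /covering_ratio; set N := covering_number r A in Nn cN *.
have p0 : 0 < r `^ (- d) by rewrite powR_gt0.
have N0 : 0 < N%:R :> R by apply: lt_le_trans cN; rewrite mulr_gt0.
have C0 : 0 < C.
  by rewrite -(pmulr_lgt0 _ p0); apply: lt_le_trans nC; apply: lt_le_trans Nn.
have lnN1 : ln c - d * ln r <= ln N%:R.
  rewrite -mulNr -ln_powR -lnM ?posrE//.
  by rewrite ler_ln ?posrE ?mulr_gt0.
have lnN2 : ln N%:R <= ln C - d * ln r.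
  rewrite -mulNr -ln_powR -lnM ?posrE//.
  by rewrite ler_ln ?posrE ?mulr_gt0// (le_trans Nn).
have K0 : 0 <= K by rewrite addr_ge0.
have Kc : `|ln c| <= K by rewrite lerDl.
have KC : `|ln C| <= K by rewrite lerDr.
have Kc' : - K <= ln c by move: Kc; rewrite ler_norml => /andP[].
have KC' : ln C <= K by move: KC; rewrite ler_norml => /andP[].
have L1 : K + 1 < e * - ln r by rewrite mulrC -ltr_pdivrMr // ltrNr.
have Lp : 0 < - ln r by rewrite -(pmulr_rgt0 _ e0); lra.
have xL : ln N%:R / - ln r * - ln r = ln N%:R by rewrite mulfVK// gt_eqF.
have eK : K < e * - ln r by apply: lt_trans L1; rewrite ltrDl.
(* Multiplied by [- ln r > 0], the goal says that [ln N + d * ln r] is below [e * - ln r] in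
   absolute value; [K] bounds it. *)
rewrite distrC -(ltr_pM2r Lp) -[X in _ * X < _](gtr0_norm Lp) -normrM mulrBl xL mulrN opprK.
apply: le_lt_trans eK; rewrite ler_norml; apply/andP; split.
  by apply: le_trans Kc' _; rewrite -lerBlDr.
by apply: le_trans KC'; rewrite -lerBrDr.
Unshelve. all: by end_near. Qed.

(** * Greedy expansions: removing and prepending a first denominator *)

Lemma invr_natB (R : realType) n : (0 < n)%N ->
  n%:R^-1 - n.+1%:R^-1 = (n * n.+1)%:R^-1 :> R.
Proof.
rewrite -(ltr0n R) natrM -natr1 => n0.
by field; rewrite !lt0r_neq0//; lra.
Qed.

Lemma unit_sum_cons (R : realType) a s l :
  unit_sum R (a :: s) l.+1 = a%:R^-1 + unit_sum R s l.
Proof. by rewrite /unit_sum big_ord_recl. Qed.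

Lemma unit_sum_ge0 (R : realType) s l : 0 <= unit_sum R s l.
Proof. by apply: sumr_ge0 => i _; rewrite invr_ge0. Qed.

Lemma egyptian_fraction_ge0 (R : realType) (x : R) s :
  is_egyptian_fraction x s -> 0 <= x.
Proof. by move=> [_ _ -> _]; exact: unit_sum_ge0. Qed.

(** Each greedy condition after the first has [1/a] on both sides, and cancelling it leaves a
    condition on the tail. The first one is the final bound, where [1 < a] rules out the infinite
    value of [1/0]. *)
Lemma egyptian_fraction_uncons (R : realType) (x : R) a s :
  is_egyptian_fraction x (a :: s) ->
  [/\ (0 < a)%N, is_egyptian_fraction (x - a%:R^-1) s &
      (1 < a)%N -> x < (a.-1)%:R^-1].
Proof.
move=> [/= /andP[a0 s0] sas xE step]; split => //.
- split => //; first exact: path_sorted sas.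
    by rewrite xE unit_sum_cons addrC addKr.
  move=> l ls; have [] := step l.+1 ls; rewrite !unit_sum_cons => le lt.
  split; first by rewrite lerBrDl.
  rewrite EFinB lteBlDr//; move: lt => /=.
  by rewrite EFinD -addeA [X in (_ < X)%E -> _]addeC.
- move=> a1; have [_] := step 0%N isT.
  rewrite /unit_sum big_ord0 add0e /= subn1 inver pnatr_eq0 gtn_eqF ?lte_fin//.
  by rewrite -ltnS prednK.
Qed.

(** Monotonicity comes for free: if [b] heads the tail, then
    [1/b <= y < 1/(a-1) - 1/a = 1/((a-1)a)], hence [b > (a-1)a >= a]. *)
Lemma egyptian_fraction_cons (R : realType) (y : R) a s :
  is_egyptian_fraction y s -> (1 < a)%N -> a%:R^-1 + y < (a.-1)%:R^-1 ->
  is_egyptian_fraction (a%:R^-1 + y) (a :: s).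
Proof.
move=> ys a1 ylt; have y0 := egyptian_fraction_ge0 ys.
have a0 : (0 < a)%N by exact: ltnW.
case: ys => s0 ss yE step; split => /=.
- by rewrite a0.
- rewrite path_min_sorted//; case: s s0 ss yE step => //= b s /andP[b0 _] bs _ step.
  rewrite (path_sortedE ltn_trans) in bs; move/andP: bs => [bs _].
  have ab : (a < b)%N.
    have [+ _] := step 0%N isT; rewrite unit_sum_cons /unit_sum big_ord0 addr0.
    move=> bx.
    have : b%:R^-1 < (a.-1)%:R^-1 - a%:R^-1 :> R by lra.
    rewrite -[a in X in _ - X](prednK a0).
    move: a1; rewrite -{1}(prednK a0) ltnS => a1.
    rewrite invr_natB//.
    rewrite ltf_pV2 ?posrE ?ltr0n ?muln_gt0 ?a1// ltr_nat prednK// => aab.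
    by apply: leq_ltn_trans aab; rewrite leq_pmull.
  rewrite ab; apply: sub_all bs => c; exact: ltn_trans.
- by rewrite unit_sum_cons yE.
- case => [_|l ls].
    rewrite unit_sum_cons /unit_sum !big_ord0 addr0 add0e/= subn1 inver.
    rewrite pnatr_eq0 gtn_eqF ?lte_fin ?lerDl//.
    by rewrite -ltnS prednK.
  have [le lt] := step l ls; rewrite !unit_sum_cons; split; first by rewrite lerD2l.
  by rewrite /= !EFinD -addeA lteD2lE.
Qed.

(** * Covering criteria and the upper bound *)

Lemma coverable_finite (R : realType) (r : R) (A : set R) (T : finType)
    (c : T -> R) :
  (forall x, A x -> exists t, c t <= x <= c t + r) -> coverable r A #|T|.
Proof.
move=> Ac; exists (c \o enum_val) => x /Ac[t ct].
by exists (enum_rank t) => //=; rewrite enum_rankK in_itv.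
Qed.

Lemma coverable_sub (R : realType) (r : R) (A B : set R) n :
  A `<=` B -> coverable r B n -> coverable r A n.
Proof. by move=> AB [c Bc]; exists c; exact: subset_trans Bc. Qed.

(** An interval of length [r] holds at most one point of the family, so choosing an interval for
    each point is injective. *)
Lemma coverable_ge_separated (R : realType) (r : R) (A : set R) n
    (T : finType) (f : T -> R) :
  (forall t, A (f t)) -> (forall t u, t != u -> r < `|f t - f u|) ->
  coverable r A n -> (#|T| <= n)%N.
Proof.
move=> Af sep [c Ac].
have /choice[g fg] : forall t, exists i : 'I_n, c i <= f t <= c i + r.
  by move=> t; have [i _ /=] := Ac _ (Af t); rewrite in_itv; exists i.
rewrite -[leqRHS]card_ord; apply: (@leq_card _ _ g) => t u gtu.
apply/eqP/negPn/negP => /sep; rewrite ltNge => /negP; apply.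
have := fg t; have := fg u; rewrite gtu ler_norml; lra.
Qed.

(** A superset of [egyptian_set_le] in which [0] is the empty sum. Removing a first denominator
    leads from level [m.+1] to level [m], which suits induction. *)
Definition short_egyptian (R : realType) (m : nat) : set R :=
  [set x | exists2 a, is_egyptian_fraction x a & (size a <= m)%N].
Arguments short_egyptian : clear implicits.

Lemma coverable_short_egyptian_step (R : realType) (r : R) m n M k :
  (0 < M)%N -> 0 < r -> M%:R^-1 < k%:R * r ->
  coverable r (short_egyptian R m) n ->
  coverable r (short_egyptian R m.+1) (M * n + k).
Proof.
move=> M0 r0 Mk [c Ac].
have -> : (M * n + k = #|{: 'I_M * 'I_n + 'I_k}|)%N.
  by rewrite card_sum card_prod !card_ord.
(* Left indices translate the given cover by [1/a] with [a = p.1 + 1] in [[1, M]]; right indices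
   tile [[0, k r]], which contains [[0, 1/M]]. *)
pose c' (t : 'I_M * 'I_n + 'I_k) : R :=
  match t with inl p => (p.1.+1)%:R^-1 + c p.2 | inr j => j%:R * r end.
apply: (@coverable_finite _ _ _ _ c') => x [a xa am].
have x0 := egyptian_fraction_ge0 xa.
have small : x <= M%:R^-1 -> exists t, c' t <= x <= c' t + r.
  move=> xM; have xr0 : 0 <= x / r by rewrite divr_ge0// ltW.
  have jk : (Num.trunc (x / r) < k)%N.
    by rewrite truncn_lt_nat// ltr_pdivrMr// (le_lt_trans xM).
  exists (inr (Ordinal jk)) => /=; have := truncn_itv xr0.
  by rewrite ler_pdivlMr// ltr_pdivrMr// -natr1 mulrDl mul1r => /andP[-> /ltW].
case: a xa am => [|a s] xa am.
  apply: small; case: xa => _ _ -> _.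
  by rewrite /unit_sum big_ord0 invr_ge0.
have [a0 xs xlt] := egyptian_fraction_uncons xa.
have [aM|Ma] := leqP a M; last first.
  (* Greediness enters here: [x < 1/(a-1) <= 1/M] once [a > M]. *)
  apply: small; apply: le_trans (ltW (xlt (leq_ltn_trans M0 Ma))) _.
  have Ma' : (M <= a.-1)%N by rewrite -ltnS prednK.
  by rewrite lef_pV2 ?posrE ?ltr0n ?ler_nat// (leq_trans M0).
have aM' : (a.-1 < M)%N by rewrite prednK.
have [] := Ac (x - a%:R^-1); first by exists s.
move=> i _ /=; rewrite in_itv /= => ci.
by exists (inl (Ordinal aM', i)) => /=; rewrite prednK//; lra.
Qed.

Lemma coverable_short_egyptian (R : realType) m :
  exists2 C : R, 0 < C & forall s : R, 1 <= s ->
    exists2 n, coverable (s ^- (2 ^ m)) (short_egyptian R m) n &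
               n%:R <= C * s ^+ (2 ^ m - 1).
Proof.
elim: m => [|m [C C0 IH]].
  exists 1 => // s s1; exists 1%N; last by rewrite subnn expr0 mulr1.
  rewrite -card_unit; apply: (@coverable_finite _ _ _ _ (fun=> 0)) => x.
  move=> [[|//] [_ _ -> _] _]; exists tt; rewrite /unit_sum big_ord0 lexx add0r.
  by rewrite invr_ge0 exprn_ge0// (le_trans _ s1).
(* [2 * C] comes from [M <= 2 s] and [n <= C s^(q-1)], and [2] from [k <= s^q + 1 <= 2 s^q]. *)
exists (2 * C + 2); first by rewrite addr_gt0 ?mulr_gt0.
move=> s s1; have s0 : 0 < s by apply: lt_le_trans s1.
have [n] := IH (s ^+ 2) (exprn_ege1 2 s1).
rewrite -!exprM -expnS => cn nC.
set q := (2 ^ m.+1 - 1)%N in nC *.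
have qE : (2 ^ m.+1 = q.+1)%N by rewrite /q subn1 prednK// expn_gt0.
(* The successors give [M > s] and [k > s^q], so with [r = s^-(q+1)] one gets
   [1/M < 1/s = s^q r < k r]. *)
pose M := (Num.trunc s).+1; pose k := (Num.trunc (s ^+ q)).+1.
have /andP[Ms sM] := truncn_itv (ltW s0).
have sq0 : 0 < s ^+ q by rewrite exprn_gt0.
have /andP[ks sk] := truncn_itv (ltW sq0).
exists (M * n + k)%N.
  apply: coverable_short_egyptian_step => //; first by rewrite invr_gt0 exprn_gt0.
  rewrite qE exprSr invfM mulrA ltr_pdivlMr//.
  apply: (@lt_trans _ _ 1).
    by rewrite mulrC ltr_pdivrMr ?mul1r ?ltr0n.
  by rewrite ltr_pdivlMr// mul1r.
have q2 : (q = (2 * (2 ^ m - 1)).+1)%N.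
  by rewrite /q expnS; move: (expn_gt0 2 m); clear; lia.
rewrite natrD natrM mulrDl.
have sq1 : 1 <= s ^+ q by exact: exprn_ege1.
apply: lerD; last by rewrite /k -natr1; lra.
have M2 : M%:R <= 2 * s by rewrite /M -natr1; lra.
rewrite {1}q2 exprS.
apply: le_trans (ler_pM _ _ M2 nC) _ => //.
by rewrite -!mulrA ler_wpM2l// mulrCA.
Qed.

(** * Separated families of greedy sums and the lower bound *)

Lemma separated_egyptian (R : realType) m S : (1 < S)%N ->
  exists (T : finType) (f : T -> R),
  [/\ (#|T| * 8 ^ m = (8 * S) ^ (2 ^ m - 1))%N,
      forall t, exists2 a, is_egyptian_fraction (f t) a & size a = m,
      forall t, f t < S.-1%:R^-1 &
      forall t u, t != u -> ((8 * S)%:R ^- (2 ^ m)) < `|f t - f u|].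
Proof.
elim: m S => [|m IH] S S1.
  exists unit, (fun=> 0); split.
  - by rewrite card_unit.
  - by move=> _; exists [::] => //; split => //; rewrite /unit_sum big_ord0.
  - by rewrite invr_gt0 ltr0n -ltnS prednK// ltnW.
  - by case; case.
have S8 : (1 < 8 * S ^ 2)%N by nia.
have [T [f [cT eT fT sT]]] := IH _ S8.
exists ('I_S * T)%type; exists (fun p : 'I_S * T => (S + p.1)%:R^-1 + f p.2).
(* Replacing [S] by [8 S^2] squares [8 S], so the separation scale of the tails is exactly the one
   required at level [m.+1]. *)
have E8 : (8 * (8 * S ^ 2) = (8 * S) ^ 2)%N by rewrite expnMn mulnA.
(* With [b = S + i < 2S], the gap [1/(b-1) - 1/b = 1/((b-1)b)] is at least [1/(8 S^2 - 1)], which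
   exceeds every tail. This is the greedy condition for [b]. *)
have tail (i : 'I_S) t : (S + i)%:R^-1 + f t < (S + i).-1%:R^-1.
  have b0 : (0 < (S + i).-1)%N by rewrite -ltnS prednK; lia.
  rewrite -ltrBrDl -{2}(@prednK (S + i)); last by lia.
  rewrite invr_natB//; apply: lt_le_trans (fT t) _.
  rewrite lef_pV2 ?posrE ?ltr0n ?muln_gt0 ?b0//; last by rewrite -ltnS prednK; lia.
  rewrite ler_nat prednK; last by lia.
  by have := ltn_ord i; move: (nat_of_ord i) => k; nia.
split.
- rewrite card_prod card_ord (expnS 8) mulnACA cT E8 -expnM.
  suff -> : (2 * (2 ^ m - 1))%N = (2 ^ m.+1 - 1).-1.
    by rewrite (mulnC S) -expnS prednK// expnS; move: (expn_gt0 2 m); lia.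
  by rewrite expnS; lia.
- move=> [i t]; have [a fa am] := eT t.
  exists ((S + i)%N :: a); last by rewrite /= am.
  by apply: egyptian_fraction_cons => //; lia.
- move=> [i t]; apply: lt_le_trans (tail i t) _.
  by rewrite lef_pV2 ?posrE ?ltr0n ?ler_nat; lia.
have f0 t : 0 <= f t by have [a fa _] := eT t; exact: egyptian_fraction_ge0 fa.
(* Distinct first denominators differ in reciprocal by at least [1/(4 S^2)], and the tail [f u]
   recovers less than [1/(7 S^2)]. What remains exceeds [1/(64 S^2)], hence the scale. *)
have gap (i j : 'I_S) t u : (i < j)%N ->
    ((8 * S)%:R ^- (2 ^ m.+1)) < `|(S + i)%:R^-1 + f t - ((S + j)%:R^-1 + f u)|.
  move=> ij; apply: lt_le_trans (ler_norm _).
  have ji : (S + j)%:R^-1 <= (S + i).+1%:R^-1 :> R.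
    by rewrite lef_pV2 ?posrE ?ltr0n ?ler_nat; lia.
  have := @invr_natB R (S + i); rewrite addn_gt0 (ltnW S1) => /(_ isT) ii.
  have iS : (4 * S ^ 2)%:R^-1 <= ((S + i) * (S + i).+1)%:R^-1 :> R.
    by rewrite lef_pV2 ?posrE ?ltr0n ?ler_nat; move: (ltn_ord j) ij; move: (nat_of_ord i) (nat_of_ord j); nia.
  have uS : f u < (7 * S ^ 2)%:R^-1.
    apply: lt_le_trans (fT u) _.
    by rewrite lef_pV2 ?posrE ?ltr0n ?ler_nat; nia.
  have rS : (8 * S)%:R ^- (2 ^ m.+1) <= (64 * S ^ 2)%:R^-1 :> R.
    rewrite -natrX lef_pV2 ?posrE ?ltr0n ?ler_nat ?expn_gt0 ?muln_gt0 ?(ltnW S1)//.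
    rewrite -[64%N]/(8 ^ 2)%N -expnMn leq_exp2l; last by lia.
    by rewrite -{1}(expn1 2) leq_exp2l.
  move: iS uS rS; rewrite (natrM _ 4) (natrM _ 7) (natrM _ 64) !invfM.
  have : 0 < (S ^ 2)%:R^-1 :> R by rewrite invr_gt0 ltr0n expn_gt0 ltnW.
  have := f0 t.
  move: (_ ^- _) (f t) (f u) ii ji (S ^ 2)%:R^-1 => r x y + + d.
  move: (S + i)%:R^-1 (S + i).+1%:R^-1 (S + j)%:R^-1 (_ * (S + i).+1)%:R^-1.
  by move=> p q w v; lra.
move=> [i t] [j u]; case: (ltngtP i j) => [ij _|ji _|/val_inj -> tu] /=.
- exact: gap.
- by rewrite distrC; exact: gap.
(* Equal first denominators cancel, leaving the separation of the tails. *)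
- rewrite opprD addrACA subrr add0r expnS exprM -natrX -E8.
  by apply: sT; apply: contraNneq tu => ->.
Qed.

Lemma rational_unit_sum (R : realType) a l : rational (unit_sum R a l).
Proof.
exists (\sum_(i < l) (nth 0%N a i)%:R^-1) => //.
by rewrite rmorph_sum; apply: eq_bigr => i _; rewrite /= fmorphV /= ratr_nat.
Qed.

Lemma mem_egyptian_set (R : realType) (x : R) a :
  is_egyptian_fraction x a -> (0 < size a)%N -> x <= 1 ->
  egyptian_set R (size a) x.
Proof.
case: a => // b s xa _ x1; split; last by exists (b :: s).
- rewrite /= in_itv/= x1 andbT.
  have [b0 xs _] := egyptian_fraction_uncons xa.
  have := egyptian_fraction_ge0 xs; rewrite subr_ge0; apply: lt_le_trans.
  by rewrite invr_gt0 ltr0n.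
- by case: xa => _ _ -> _; exact: rational_unit_sum.
Qed.

Lemma coverable_egyptian_set_ge (R : realType) m : (0 < m)%N ->
  exists2 c : R, 0 < c & forall s : R, 16 <= s ->
    forall n, coverable (s ^- (2 ^ m)) (egyptian_set R m) n ->
              c * s ^+ (2 ^ m - 1) <= n%:R.
Proof.
move=> m0; set q := (2 ^ m - 1)%N.
(* [2^q] pays for rounding [s / 8] down to [S], as [8 S >= s / 2]; [8^m] is the factor in the count
   of the separated family. *)
exists ((2 ^+ q)^-1 * (8 ^+ m)^-1); first by rewrite mulr_gt0 ?invr_gt0 ?exprn_gt0.
move=> s s16 n cov.
have s0 : 0 < s by lra.
have s8 : 0 <= s / 8 by lra.
have /andP[Ss sS] := truncn_itv s8; set S := Num.trunc _ in Ss sS.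
(* The threshold [16] is what ensures [S >= 2]. *)
have S1 : (1 < S)%N by rewrite truncn_ge_nat//; lra.
have [T [f [cT eT fT sT]]] := separated_egyptian R m S1.
have S8s : (8 * S)%:R <= s by rewrite natrM; lra.
have s2S : s / 2 <= (8 * S)%:R.
  by rewrite natrM; move: sS S1; rewrite -(natr1 S) -(ler_nat R); lra.
have Tn : (#|T| <= n)%N.
  apply: (coverable_ge_separated (f := f)) cov => [t|t u tu].
  - have [a fa am] := eT t; rewrite -am; apply: mem_egyptian_set; rewrite ?am//.
    apply: le_trans (ltW (fT t)) _; rewrite invf_le1 ?ltr0n ?ler1n; lia.
  - apply: le_lt_trans (sT t u tu).
    rewrite lef_pV2 ?posrE ?exprn_gt0 ?ltr0n ?muln_gt0 ?(ltnW S1)//.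
    by rewrite lerXn2r ?nnegrE// ltW.
rewrite -(ler_nat R) in Tn; apply: le_trans Tn.
rewrite mulrAC ler_pdivrMr ?exprn_gt0// -[8 ^+ m]natrX -natrM cT natrX.
rewrite mulrC -expr_div_n lerXn2r ?nnegrE//; lra.
Qed.

(** * Dimension of the sets between [egyptian_set] and [egyptian_set_le] *)

Lemma egyptian_set_le_short (R : realType) m :
  egyptian_set_le R m `<=` short_egyptian R m.
Proof.
move=> x [[_ /= ->|p pm [_ _ [a xa am]]]]; last by exists a => //; rewrite am.
by exists [::] => //; split => //; rewrite /unit_sum big_ord0.
Qed.

Lemma egyptian_set_le_itv (R : realType) m :
  egyptian_set_le R m `<=` [set x | `|x| <= 1].
Proof.
move=> x [[_ /= ->|p pm [+ _ _]]]; first by rewrite normr0.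
by rewrite /= in_itv /= => /andP[x0 x1]; rewrite gtr0_norm.
Qed.

(** Coverability passes to subsets, so the lower bound is inherited from [egyptian_set] and the
    upper one from [egyptian_set_le]; both claims of the theorem are instances. *)
Lemma minkowski_dim_between (R : realType) m (A : set R) : (0 < m)%N ->
  egyptian_set R m `<=` A -> A `<=` egyptian_set_le R m ->
  has_minkowski_dim A (1 - 1 / 2 ^+ m).
Proof.
move=> m0 EA AE.
have [C C0 up] := coverable_short_egyptian R m.
have [c c0 low] := coverable_egyptian_set_ge R m0.
(* This solves [r = s^-(2^m)] for [s], and turns [s^(2^m - 1)] into [r] to the power
   [-(1 - 1/2^m)]. *)
pose s (r : R) := r `^ (- (2 ^+ m)^-1).
have s0 r : 0 < r -> 0 < s r by exact: powR_gt0.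
have p2 : 2 ^+ m != 0 :> R by rewrite expf_neq0.
have sX r : 0 < r -> s r ^- (2 ^ m) = r.
  move=> r0; rewrite -powR_mulrn ?(ltW (s0 _ r0))// -powRrM natrX mulNr mulVf//.
  by rewrite powRN powRr1 ?invrK// ltW.
have sq r : 0 < r -> s r ^+ (2 ^ m - 1) = r `^ (- (1 - 1 / 2 ^+ m)).
  move=> r0; rewrite -powR_mulrn ?(ltW (s0 _ r0))// -powRrM.
  by rewrite natrB ?expn_gt0// natrX; congr (_ `^ _); field.
have s16 : \forall r \near 0^'+, 16 <= s r.
  near=> r; have r0 : 0 < r by near: r; exact: nbhs_right_gt.
  have : r <= 16 ^- (2 ^ m).
    by near: r; apply: nbhs_right_le; rewrite invr_gt0 exprn_gt0.
  rewrite -{1}(sX r r0) lef_pV2 ?posrE ?exprn_gt0 ?s0//.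
  by rewrite ler_pXn2r ?nnegrE ?(ltW (s0 _ r0)) ?expn_gt0.
have AS : A `<=` short_egyptian R m.
  by apply: subset_trans AE _; exact: egyptian_set_le_short.
apply: (@has_minkowski_dim_power_bounds _ _ _ c C) => //.
(* Taking [S = 2] yields a nonempty family of sums below [1/(2-1) = 1]. *)
- have [T [f [cT eT fT _]]] := separated_egyptian R m (ltnSn 1).
  have /card_gt0P[t _] : (0 < #|T|)%N.
    by have := expn_gt0 (8 * 2) (2 ^ m - 1); rewrite -cT muln_gt0 => /andP[].
  exists (f t); apply: EA; have [a fa am] := eT t.
  rewrite -am; apply: mem_egyptian_set; rewrite ?am//.
  by have := fT t; rewrite invr1 => /ltW.
- exists 1; split => // M M1 x /AE/egyptian_set_le_itv /= x1.
  exact: le_trans (ltW M1).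
- near=> r; have r0 : 0 < r by near: r; exact: nbhs_right_gt.
  have r16 : 16 <= s r by near: r.
  have [|n cov nC] := up (s r); first by apply: le_trans r16; rewrite ler1n.
  exists n; last by rewrite -sq.
  by rewrite -(sX r r0); exact: coverable_sub cov.
- near=> r => n cov; have r0 : 0 < r by near: r; exact: nbhs_right_gt.
  have r16 : 16 <= s r by near: r.
  rewrite -sq//; apply: low => //; rewrite sX//; exact: coverable_sub cov.
Unshelve. all: by end_near. Qed.

Theorem theorem1p3 (R : realType) (m : nat) (hm : (0 < m)%N) :
  has_minkowski_dim (egyptian_set R m) (1 - 1 / 2 ^+ m) /\
  has_minkowski_dim (egyptian_set_le R m) (1 - 1 / 2 ^+ m).
Proof.
have sub : egyptian_set R m `<=` egyptian_set_le R m.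
  by move=> x Ex; exists m => //=.
by split; exact: minkowski_dim_between.
Qed.
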